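(* Let $n\ge5$ and let $A\in\mathbb{R}^{n\times n}$ be the clamped-clamped matrix defined in the context. The inverse of $A$ is a positive matrix, i.e. all its entries are strictly positive. Furthermore, denoting by $a^{-1}_{ij}$ the $(i,j)$-entry of $A^{-1}$ and setting, for $i,j\in\{1,\dots,n\}$, $$\alpha=n+1-i,\qquad \beta=\frac{j\alpha}{6(n+1)(n^2+2n+3)},\qquad \varepsilon=3\bigl(1+\alpha(n+1)\bigr)\bigl(1+(i-j)j\bigr),$$ the entries of $A^{-1}$ are $$a^{-1}_{ij}=\beta\bigl(\varepsilon+(j^2-1)(2\alpha^2+1)\bigr)\quad\text{for } i\ge j,$$ $$a^{-1}_{ij}=a^{-1}_{ji}\quad\text{otherwise}.$$
   Context: The clamped-clamped matrix $A=[a_{i,j}]_{i,j=1}^n$ is the symmetric pentadiagonal matrix whose nonzero entries are: $a_{1,1}=a_{n,n}=7$; $a_{i,i}=6$ for $2\le i\le n-1$; $a_{i,i+1}=a_{i+1,i}=-4$ for $1\le i\le n-1$; $a_{i,i+2}=a_{i+2,i}=1$ for $1\le i\le n-2$. All other entries are $0$. The matrix $A$ is symmetric positive definite, hence nonsingular. *)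

(* Defs.v *)
From HB Require Import structures.
From mathcomp Require Import all_boot all_order all_algebra.

Set Implicit Arguments.
Unset Strict Implicit.
Unset Printing Implicit Defensive.

Import Order.TTheory GRing.Theory Num.Theory.
Local Open Scope ring_scope.

(* Ordinals are 0-based, so the corner entries equal to 7 are those at
   indices 0 and n.-1. *)
Definition clamped_mx (R : nzRingType) (n : nat) : 'M[R]_n :=
  \matrix_(i < n, j < n)
    if i == j then
      if (i == 0 :> nat) || (i == n.-1 :> nat) then 7 else 6
    else if (j == i.+1 :> nat) || (i == j.+1 :> nat) then -4
    else if (j == i.+2 :> nat) || (i == j.+2 :> nat) then 1
    else 0.

(* In the formulas below i and j are the 1-based indices, cast into the field
   so that every subtraction is a field subtraction. *)
Section InverseEntries.

Variables (R : fieldType) (n : nat).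
Implicit Types i j : nat.

Definition cc_alpha i : R := n%:R + 1 - i%:R.

Definition cc_beta i j : R :=
  j%:R * cc_alpha i / (6 * (n%:R + 1) * (n%:R ^+ 2 + 2 * n%:R + 3)).

Definition cc_eps i j : R :=
  3 * (1 + cc_alpha i * (n%:R + 1)) * (1 + (i%:R - j%:R) * j%:R).

Definition cc_inv_entry i j : R :=
  cc_beta i j * (cc_eps i j + (j%:R ^+ 2 - 1) * (2 * cc_alpha i ^+ 2 + 1)).

End InverseEntries.

(* Main.v *)
Require Import Defs.
From mathcomp Require Import all_boot all_order all_algebra.
From mathcomp Require Import zify ring lra.

Set Implicit Arguments.
Unset Strict Implicit.
Unset Printing Implicit Defensive.

Import Order.TTheory GRing.Theory Num.Theory.
Local Open Scope ring_scope.

(** The clamped-clamped matrix is the centred fourth difference acting on a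
    grid function that has been extended by two ghost nodes on each side: the
    function vanishes at the first ghost nodes 0 and n + 1 and is reflected
    there, u(-1) = u(1) and u(n+2) = u(n).  The reflection is what turns the
    corner 6 into 7 ([clamped_mx_fourth_difference]).  Inverting the matrix
    thus amounts to finding the discrete Green's function, column by column.

    For a fixed column j the claimed entry is a cubic polynomial of the row
    index x on each side of the diagonal.  Hence its fourth difference vanishes
    away from the diagonal, and the lower (x >= j) and upper (x <= j) cubics
    satisfy the boundary conditions at the right and left end respectively.  The lower cubic minus the upper
    one is (x - j) ((x - j)^2 - 1) / 6 ([green_jump]): the two agree at the
    three nodes j - 1, j, j + 1 and differ by 1 at j + 2.  So every five-point
    stencil not centred at j sees a single cubic and gives 0, while the stencil
    centred at j sees the upper cubic plus 1 at its last node, and gives 1.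

    Positivity is read off the formula after writing n + 1 = alpha + i and
    i = j + d with d >= 0: only nonnegative terms remain, and one of
    them is positive ([green_gt0]). *)

(** * Fourth differences with clamped ends *)

Lemma sum_ord_delta (R : nzRingType) (n m : nat) (f : nat -> R) :
  \sum_(k < n) (k == m :> nat)%:R * f k = if (m < n)%N then f m else 0.
Proof.
case: ltnP => [lt_mn|le_nm].
  rewrite (bigD1 (Ordinal lt_mn)) //= eqxx mul1r big1 ?addr0 // => k.
  by rewrite -val_eqE /= => /negPf ->; rewrite mul0r.
by rewrite big1 // => k _; rewrite ltn_eqF ?mul0r // (leq_trans _ le_nm).
Qed.

(** Splitting a row into five diagonals and two corner corrections reduces
    every row of a matrix-vector product to [sum_ord_delta].  The tests on the
    two subdiagonals are written [k.+1 == i] and [k.+2 == i], so that no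
    truncated subtraction occurs in the first two rows. *)
Lemma clamped_mxE (R : comNzRingType) (n : nat) (i k : 'I_n) : (1 < n)%N ->
  clamped_mx R n i k =
    (k.+2 == i :> nat)%:R - 4 * (k.+1 == i :> nat)%:R
    + (6 + (i == 0 :> nat)%:R + (i == n.-1 :> nat)%:R) * (k == i :> nat)%:R
    - 4 * (k == i.+1 :> nat)%:R + (k == i.+2 :> nat)%:R.
Proof.
move=> n_gt1; rewrite mxE -val_eqE /= (eq_sym (i : nat) k).
rewrite (eq_sym (i : nat) k.+1) (eq_sym (i : nat) k.+2).
have neqS m : [/\ m.+1 == m = false, m.+2 == m = false & m.+3 == m = false].
  by split; lia.
have neSn m : [/\ m == m.+1 = false, m == m.+2 = false & m == m.+3 = false].
  by split; lia.
have [->|neq_ki] := eqVneq (k : nat) i.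
  have [-> -> _] := neqS i; have [-> -> _] := neSn i.
  have [i0|_] := eqVneq (i : nat) 0; have [in1|_] := eqVneq (i : nat) n.-1;
    rewrite /=; [lia | ring..].
have [->|neq1] := eqVneq (k : nat) i.+1.
  by have [_ -> ->] := neqS i; have [-> _ _] := neSn i.+1; rewrite /=; ring.
have [<-|neq2] := eqVneq k.+1 i.
  by have [-> _ _] := neqS k.+1; have [_ _ ->] := neSn k; rewrite /=; ring.
have [->|neq3] := eqVneq (k : nat) i.+2.
  by rewrite (_ : i.+4 == i = false) /=; [ring | lia].
by case: (k.+2 == i); rewrite /=; ring.
Qed.

(** Node [k] of the extended grid is the value [v k]: the matrix acts on nodes
    2 to n + 1, and the hypotheses are the clamped conditions at the two ghost
    nodes on each side.  The bound on [n] excludes the 1 x 1 matrix, whose only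
    entry is 7 although both reflections act on it. *)
Lemma clamped_mx_fourth_difference (R : comNzRingType) (n : nat) (v : nat -> R)
    (i : 'I_n) :
    (1 < n)%N -> v 1 = 0 -> v 0 = v 2 -> v n.+2 = 0 -> v n.+3 = v n.+1 ->
  \sum_(k < n) clamped_mx R n i k * v k.+2 =
    v i - 4 * v i.+1 + 6 * v i.+2 - 4 * v i.+3 + v i.+4.
Proof.
move=> n_gt1 v1 v0 vn2 vn3; have lt_in := ltn_ord i.
pose D m := \sum_(k < n) (k == m :> nat)%:R * v k.+2.
have DE m : D m = if (m < n)%N then v m.+2 else 0.
  exact: (sum_ord_delta n m (fun k => v k.+2)).
have E1 : \sum_(k < n) (k.+1 == i :> nat)%:R * v k.+2 = v i.+1.
  case: (nat_of_ord i) lt_in => [|m] lt_mn.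
    by rewrite v1 big1 // => k _; rewrite mul0r.
  by rewrite -[LHS]/(D m) DE ltnW.
have E2 : \sum_(k < n) (k.+2 == i :> nat)%:R * v k.+2 =
    v i - (i == 0 :> nat)%:R * v i.+2.
  case: (nat_of_ord i) lt_in => [|[|m]] lt_mn.
  - by rewrite v0 big1 => [|k _]; [rewrite /=; ring | rewrite mul0r].
  - by rewrite v1 big1 => [|k _]; [rewrite /=; ring | rewrite mul0r].
  by rewrite -[LHS]/(D m) DE (ltnW (ltnW lt_mn)) /= mul0r subr0.
have F0 : D i = v i.+2 by rewrite DE lt_in.
have F1 : D i.+1 = v i.+3.
  by rewrite DE; case: ltnP => // le_n; have -> : i.+3 = n.+2 by lia.
have F2 : D i.+2 = v i.+4 - (i == n.-1 :> nat)%:R * v i.+2.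
  rewrite DE; case: ltnP => [lt_n|le_n].
    by rewrite ltn_eqF ?mul0r ?subr0 //; lia.
  have [in1|nin1] := eqVneq (i : nat) n.-1; rewrite /=.
    have [-> ->] : i.+4 = n.+3 /\ i.+2 = n.+1 by lia.
    by rewrite vn3 mul1r subrr.
  by have -> : i.+4 = n.+2 by [lia]; rewrite vn2 mul0r subr0.
pose c : R := 6 + (i == 0 :> nat)%:R + (i == n.-1 :> nat)%:R.
have rowE (k : 'I_n) : clamped_mx R n i k * v k.+2 =
    (k.+2 == i :> nat)%:R * v k.+2 + (- 4) * ((k.+1 == i :> nat)%:R * v k.+2)
    + c * ((k == i :> nat)%:R * v k.+2)
    + (- 4) * ((k == i.+1 :> nat)%:R * v k.+2) + (k == i.+2 :> nat)%:R * v k.+2.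
  by rewrite clamped_mxE // -/c; ring.
under eq_bigr => k _ do rewrite rowE.
rewrite !big_split /= -!mulr_sumr E1 E2 -/(D i) -/(D i.+1) -/(D i.+2).
by rewrite F0 F1 F2 /c; ring.
Qed.

(** * The cubic branches of the Green's function *)

(** The closed form of the entries with real instead of natural indices, so
    that it makes sense at the ghost nodes and [field] applies to it.  At natural
    indices it is convertible to [cc_inv_entry]. *)
Definition green (R : fieldType) (N x y : R) : R :=
  let a := N + 1 - x in
  y * a / (6 * (N + 1) * (N ^+ 2 + 2 * N + 3)) *
  (3 * (1 + a * (N + 1)) * (1 + (x - y) * y) + (y ^+ 2 - 1) * (2 * a ^+ 2 + 1)).

Section Green.

Variables (R : realFieldType) (N : R).
Hypothesis N_ge0 : 0 <= N.

Let N1_neq0 : N + 1 != 0.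
Proof. by have N0 := N_ge0; rewrite gt_eqF //; lra. Qed.

Let Nq_gt0 : 0 < N ^+ 2 + 2 * N + 3.
Proof. by have N0 := N_ge0; have := sqr_ge0 N; lra. Qed.

Let Nq_neq0 : N ^+ 2 + 2 * N + 3 != 0.
Proof. by rewrite gt_eqF. Qed.

(** The right-hand side vanishes for x - y in {-1, 0, 1} and equals 1 for
    x - y = 2: set to 0 for x <= y, it becomes a function whose fourth difference
    in x is the discrete delta at y, which glues the two branches. *)
Lemma green_jump x y :
  green N x y - green N y x = (x - y) * ((x - y) ^+ 2 - 1) / 6.
Proof. by rewrite /green; field; rewrite N1_neq0 Nq_neq0. Qed.

Lemma green_row_fourth_difference x y :
  green N (x - 2) y - 4 * green N (x - 1) y + 6 * green N x y
    - 4 * green N (x + 1) y + green N (x + 2) y = 0.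
Proof. by rewrite /green; field; rewrite N1_neq0 Nq_neq0. Qed.

Lemma green_col_fourth_difference x y :
  green N x (y - 2) - 4 * green N x (y - 1) + 6 * green N x y
    - 4 * green N x (y + 1) + green N x (y + 2) = 0.
Proof. by rewrite /green; field; rewrite N1_neq0 Nq_neq0. Qed.

Lemma green_clamped_left x : green N x 0 = 0 /\ green N x (-1) = green N x 1.
Proof. by rewrite /green; split; field; rewrite N1_neq0 Nq_neq0. Qed.

Lemma green_clamped_right y :
  green N (N + 1) y = 0 /\ green N (N + 2) y = green N N y.
Proof. by rewrite /green; split; field; rewrite N1_neq0 Nq_neq0. Qed.

(** With a = N + 1 - x, the last factor is a sum of products of the nonnegative
    quantities (x - y) y, a (N + 1), y^2 - 1 and a^2 with positive constants,
    and it is at least 3. *)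
Lemma green_gt0 x y : 1 <= y -> y <= x -> x <= N -> 0 < green N x y.
Proof.
move=> y_ge1 le_yx le_xN; rewrite /green /=.
have N0 := N_ge0; have a_gt0 : 0 < N + 1 - x by lra.
have yd_ge0 : 0 <= (x - y) * y by apply: mulr_ge0; lra.
have aN_ge0 : 0 <= (N + 1 - x) * (N + 1) by apply: mulr_ge0; lra.
have y2_ge0 : 0 <= y ^+ 2 - 1 by nra.
have a2_ge0 := sqr_ge0 (N + 1 - x).
apply: mulr_gt0.
  by rewrite divr_gt0 ?mulr_gt0 //; lra.
by rewrite ltr_wpDr ?mulr_ge0 ?mulr_gt0 //; lra.
Qed.

End Green.

(** * The inverse matrix *)

Definition green_mx (R : fieldType) (n : nat) : 'M[R]_n :=
  \matrix_(i, j) if (j <= i)%N then cc_inv_entry R n i.+1 j.+1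
                 else cc_inv_entry R n j.+1 i.+1.

(** The entry of column [j] at extended node [k], which sits at abscissa
    [k - 1]; node 0 is the left outer ghost node. *)
Definition green_col (R : fieldType) (n j k : nat) : R :=
  if (k <= j.+1)%N then green n%:R j.+1%:R (k%:R - 1)
  else green n%:R (k%:R - 1) j.+1%:R.

Section InverseMatrix.

Variables (R : realFieldType) (n : nat).

Lemma green_col_ge j k : (j < k)%N ->
  green_col R n j k = green n%:R (k%:R - 1) j.+1%:R.
Proof.
move=> lt_jk; rewrite /green_col; case: leqP => // le_kj.
apply/eqP; rewrite eq_sym -subr_eq0 green_jump ?ler0n //.
by have -> : k = j.+1 by [lia]; apply/eqP; rewrite [j.+1%:R]mulrSr; field.
Qed.

(** The range overlaps that of [green_col_ge] in the three nodes around the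
    diagonal; this overlap is what lets an off-diagonal five-point stencil fit
    inside a single branch. *)
Lemma green_col_le j k : (k <= j.+3)%N ->
  green_col R n j k = green n%:R j.+1%:R (k%:R - 1).
Proof.
move=> le_kj; rewrite /green_col; case: leqP => // lt_jk.
apply/eqP; rewrite -subr_eq0 green_jump ?ler0n //.
have [->|->] : k = j.+2 \/ k = j.+3 by lia.
  by apply/eqP; rewrite !mulrS; field.
by apply/eqP; rewrite !mulrS; field.
Qed.

Lemma green_mxE (i j : 'I_n) : green_mx R n i j = green_col R n j i.+2.
Proof.
have e : i.+2%:R - 1 = i.+1%:R :> R by rewrite !mulrS; ring.
rewrite mxE; case: leqP => [le_ji|lt_ij].
  by rewrite green_col_ge ?e //; lia.
by rewrite green_col_le ?e //; lia.
Qed.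

(** Nodes [i] to [i.+4] lie on the upper branch if [i < j] and on the lower one
    if [j < i]; if [i = j], only the last node leaves the upper branch, and the
    jump there is the value of the delta. *)
Lemma green_col_fourth_differenceE i j :
  green_col R n j i - 4 * green_col R n j i.+1 + 6 * green_col R n j i.+2
    - 4 * green_col R n j i.+3 + green_col R n j i.+4 = (i == j)%:R.
Proof.
have N_ge0 : 0 <= n%:R :> R by exact: ler0n.
have e0 : i%:R - 1 = i.+1%:R - 2 :> R by rewrite !mulrS; ring.
have e2 : i.+2%:R - 1 = i.+1%:R :> R by rewrite !mulrS; ring.
have e3 : i.+3%:R - 1 = i.+1%:R + 1 :> R by rewrite !mulrS; ring.
have e4 : i.+4%:R - 1 = i.+1%:R + 2 :> R by rewrite !mulrS; ring.
case: (ltngtP i j) => [lt_ij|lt_ji|<-].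
- rewrite !green_col_le ?e0 ?e2 ?e3 ?e4; try lia.
  exact: green_col_fourth_difference.
- rewrite !green_col_ge ?e0 ?e2 ?e3 ?e4; try lia.
  exact: green_row_fourth_difference.
have U := green_col_fourth_difference N_ge0 i.+1%:R i.+1%:R.
rewrite (@green_col_ge i i.+4) ?e4; last by lia.
rewrite !green_col_le ?e0 ?e2 ?e3; try lia.
have J := green_jump N_ge0 (i.+1%:R + 2) i.+1%:R.
have J1 : (i.+1%:R + 2 - i.+1%:R) * ((i.+1%:R + 2 - i.+1%:R) ^+ 2 - 1) / 6
    = 1 :> R.
  by field.
by rewrite J1 in J; rewrite /=; lra.
Qed.

Lemma clamped_mx_mul_green : (1 < n)%N -> clamped_mx R n *m green_mx R n = 1%:M.
Proof.
move=> n_gt1; have N_ge0 : 0 <= n%:R :> R by exact: ler0n.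
apply/matrixP => i j; have lt_jn := ltn_ord j; rewrite !mxE.
under eq_bigr => k _ do rewrite green_mxE.
rewrite clamped_mx_fourth_difference //.
- by rewrite green_col_fourth_differenceE.
- by rewrite green_col_le // subrr; case: (green_clamped_left N_ge0 j.+1%:R).
- rewrite !green_col_le // sub0r [2 - 1](_ : _ = 1); last by ring.
  by case: (green_clamped_left N_ge0 j.+1%:R).
- rewrite green_col_ge; last by lia.
  rewrite [n.+2%:R - 1](_ : _ = n%:R + 1); last by rewrite !mulrS; ring.
  by case: (green_clamped_right N_ge0 j.+1%:R).
rewrite !green_col_ge; try lia.
rewrite [n.+3%:R - 1](_ : _ = n%:R + 2); last by rewrite !mulrS; ring.
rewrite [n.+1%:R - 1](_ : _ = n%:R); last by rewrite !mulrS; ring.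
by case: (green_clamped_right N_ge0 j.+1%:R).
Qed.

Lemma cc_inv_entry_gt0 (i j : 'I_n) : (j <= i)%N ->
  0 < cc_inv_entry R n i.+1 j.+1.
Proof.
by move=> le_ji; apply: (@green_gt0 R n%:R); rewrite ?ler0n ?ler1n ?ler_nat.
Qed.

End InverseMatrix.

Theorem theorem3p1 (R : realFieldType) (n : nat) (hn : (5 <= n)%N) :
  [/\ clamped_mx R n \in unitmx,
      (forall i j : 'I_n, 0 < invmx (clamped_mx R n) i j),
      (forall i j : 'I_n, (j <= i)%N ->
         invmx (clamped_mx R n) i j = cc_inv_entry R n i.+1 j.+1)
    & (forall i j : 'I_n, (i < j)%N ->
         invmx (clamped_mx R n) i j = invmx (clamped_mx R n) j i)].
Proof.
have AG : clamped_mx R n *m green_mx R n = 1%:M.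
  by apply: clamped_mx_mul_green; lia.
have [uA _] := mulmx1_unit AG.
have -> : invmx (clamped_mx R n) = green_mx R n.
  by rewrite -[LHS]mulmx1 -AG mulKmx.
split=> // i j => [|le_ji|lt_ij].
- by rewrite mxE; case: leqP => [|/ltnW] le; apply: cc_inv_entry_gt0.
- by rewrite mxE le_ji.
by rewrite !mxE (ltnW lt_ij) leqNgt lt_ij.
Qed.
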